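(* Let $|\psi\rangle$ be a normalized Majorana dimer state vector on $L$ spins, and let $A\subseteq\{1,\dots,L\}$ be a connected subsystem, i.e. a set of consecutive sites in the cyclic order $1,2,\dots,L,1$. Let $A^{\mathrm C}$ be the complement of $A$ and $\rho_A=\mathrm{tr}_{A^{\mathrm C}}|\psi\rangle\langle\psi|$. Then the entanglement entropy $S_A=-\mathrm{tr}(\rho_A\log\rho_A)$ is $$S_A=\frac{\log 2}{2}\cdot\#\{\text{dimers with one end on a site of }A\text{ and the other on a site of }A^{\mathrm C}\}.$$
   Context: Majorana operators. On $L$ spins, with Hilbert space $(\mathbb{C}^2)^{\otimes L}$ and Pauli operators $X_k,Y_k,Z_k$ on site $k$, put $\gamma_{2k-1}=Z_1\cdots Z_{k-1}X_k$ and $\gamma_{2k}=Z_1\cdots Z_{k-1}Y_k$. The modes $2k-1$ and $2k$ are said to lie on site $k$. Majorana dimer state. A nonzero vector $|\psi\rangle$ is a Majorana dimer state vector if there are a partition $\Omega$ of $\{1,\dots,2L\}$ into $L$ pairs $(j,k)$ with $j<k$ (the dimers) and signs $p_{j,k}\in\{\pm1\}$ such that $(\gamma_j+\mathrm{i}\,p_{j,k}\gamma_k)|\psi\rangle=0$ for all $(j,k)\in\Omega$. *)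

(* Defs.v *)
From HB Require Import structures.
From mathcomp Require Import all_boot all_order all_algebra.
From mathcomp Require Import spectral sesquilinear complex.
From mathcomp Require Import reals exp.

Set Implicit Arguments.
Unset Strict Implicit.
Unset Printing Implicit Defensive.

Import Order.TTheory GRing.Theory Num.Theory.
Local Open Scope ring_scope.
Local Open Scope complex_scope.
Local Open Scope sesquilinear_scope.

(* Computational-basis labels of the spins in A; the tensor product of the
   spaces C^2 over the sites of A is C^(config A), whose vectors and operators
   are matrices indexed through enum_rank / enum_val. *)
Definition config (L : nat) (A : {set 'I_L}) : finType :=
  {ffun {i : 'I_L | i \in A} -> 'I_2}.

Definition spins (L : nat) : finType := {ffun 'I_L -> 'I_2}.

Section Operators.
Variable R : realType.
Local Notation C := R[i].

Definition sigma_x : 'M[C]_2 := \matrix_(a, b) (if a == b then 0 else 1).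

Definition sigma_y : 'M[C]_2 :=
  \matrix_(a, b) (if a == b then 0 else if a == ord0 then - 'i%R else 'i%R).

Definition sigma_z : 'M[C]_2 :=
  \matrix_(a, b) (if a == b then (if a == ord0 then 1 else -1) else 0).

(* 1 (x) ... (x) P (x) ... (x) 1, with P acting on site k. *)
Definition on_site (L : nat) (k : 'I_L) (P : 'M[C]_2) : 'M[C]_#|spins L| :=
  \matrix_(a, b)
    let s : spins L := enum_val a in let t : spins L := enum_val b in
    if [forall i, (i != k) ==> (s i == t i)] then P (s k) (t k) else 0.

Lemma site_subproof (L : nat) (j : 'I_(2 * L)) : (j./2 < L)%N.
Proof. by rewrite ltn_half_double -mul2n. Qed.

(* Sites and modes are numbered from 0: modes 2k and 2k+1 lie on site k. *)
Definition site (L : nat) (j : 'I_(2 * L)) : 'I_L :=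
  Ordinal (site_subproof j).

Definition majorana (L : nat) (j : 'I_(2 * L)) : 'M[C]_#|spins L| :=
  (\prod_(i < L | (i < site j)%N) on_site i sigma_z)
    *m on_site (site j) (if odd j then sigma_y else sigma_x).

Definition dimer_partition (L : nat)
    (Omega : {set 'I_(2 * L) * 'I_(2 * L)}) : bool :=
  [&& #|Omega| == L,
      [forall d in Omega, (d.1 < d.2)%N]
    & partition [set [set d.1; d.2] | d in Omega] [set: 'I_(2 * L)]].

(* The sign of the dimer d is (-1) ^+ p d. *)
Definition majorana_dimer_state (L : nat)
    (Omega : {set 'I_(2 * L) * 'I_(2 * L)})
    (p : 'I_(2 * L) * 'I_(2 * L) -> bool) (psi : 'cV[C]_#|spins L|) : Prop :=
  [/\ psi != 0, dimer_partition Omega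
    & forall d, d \in Omega ->
        (majorana d.1 + ('i%R * (-1) ^+ p d) *: majorana d.2) *m psi = 0].

Definition restr (L : nat) (A : {set 'I_L}) (s : spins L) : config A :=
  [ffun i => s (val i)].

(* Partial trace over the complement of A: <s| tr M |t> is the sum over the
   environment labels e of <s,e| M |t,e>. *)
Definition ptrace (L : nat) (A : {set 'I_L}) (M : 'M[C]_#|spins L|) :
    'M[C]_#|config A| :=
  \matrix_(a, b)
    \sum_(x : spins L | restr A x == enum_val a)
      \sum_(y : spins L | (restr A y == enum_val b)
                          && (restr (~: A) y == restr (~: A) x))
        M (enum_rank x) (enum_rank y).

(* Logarithm of a positive semidefinite matrix by functional calculus.  Since
   ln 0 = 0, it vanishes on the kernel, so M *m mxlog M realizes the usual
   convention 0 log 0 = 0. *)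
Definition mxlog (n : nat) (M : 'M[C]_n) : 'M[C]_n :=
  invmx (spectralmx M)
    *m diag_mx (map_mx (fun z : C => (ln (complex.Re z))%:C) (spectral_diag M))
    *m spectralmx M.

Definition entropy (n : nat) (M : 'M[C]_n) : C := - \tr (M *m mxlog M).

Definition entanglement_entropy (L : nat) (psi : 'cV[C]_#|spins L|)
    (A : {set 'I_L}) : C :=
  entropy (ptrace A (psi *m psi ^t*)).

End Operators.

(* l consecutive sites in the cyclic order, starting from site a. *)
Definition connected_subsystem (L : nat) (A : {set 'I_L}) : Prop :=
  exists a l : nat, (l <= L)%N /\
    A = [set i : 'I_L | [exists m : 'I_l, val i == ((a + m) %% L)%N]].

Definition crossing_dimers (L : nat)
    (Omega : {set 'I_(2 * L) * 'I_(2 * L)}) (A : {set 'I_L}) :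
    {set 'I_(2 * L) * 'I_(2 * L)} :=
  [set d in Omega | ((site d.1 \in A) && (site d.2 \in ~: A))
                    || ((site d.2 \in A) && (site d.1 \in ~: A))].

(* Main.v *)
Require Import Defs.
From HB Require Import structures.
From mathcomp Require Import all_boot all_order all_algebra.
From mathcomp Require Import spectral sesquilinear complex.
From mathcomp Require Import reals exp.
From mathcomp Require Import zify.

Set Implicit Arguments.
Unset Strict Implicit.
Unset Printing Implicit Defensive.

Import Order.TTheory GRing.Theory Num.Theory.
Local Open Scope ring_scope.
Local Open Scope complex_scope.
Local Open Scope sesquilinear_scope.

(* A dimer (j, k) with sign p turns psi into a fixed vector of the self-adjoint
   involution g = - i p gamma_j gamma_k.  The g's commute, and the product of the
   projections (1 + g) / 2 has trace 1, so it equals |psi><psi|.  Let A be an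
   interval.  A product of distinct g's, not all inside A, has zero partial trace,
   because it anticommutes with some Pauli operator on a single site outside A.
   Hence the dimers that leave A contribute a scalar, and rho_A is that scalar
   kappa times the product of the (1 + g) / 2 of the dimers inside A, which fixes
   rho_A; so rho_A ^ 2 = kappa rho_A and S_A = - log kappa.  A cyclic interval is
   an interval or the complement of one, and the Schmidt matrix of psi transports
   rho ^ 2 = kappa rho to the complement, whatever the Jordan-Wigner strings do
   there. *)

(** * Conjugate transposes and orthogonal projections *)

Section Adjoint.
Variable C : numClosedFieldType.

Lemma adjmxE m n (M : 'M[C]_(m, n)) i j : (M ^t*) i j = (M j i)^*%R.
Proof. by rewrite !mxE. Qed.

Lemma adjmxM m n q (M : 'M[C]_(m, n)) (N : 'M[C]_(n, q)) :
  (M *m N) ^t* = N ^t* *m M ^t*.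
Proof. by rewrite trmx_mul map_mxM. Qed.

Lemma adjmxD m n (M N : 'M[C]_(m, n)) : (M + N) ^t* = M ^t* + N ^t*.
Proof. by rewrite linearD map_mxD. Qed.

Lemma adjmxZ m n a (M : 'M[C]_(m, n)) : (a *: M) ^t* = a^*%R *: M ^t*.
Proof. by rewrite linearZ map_mxZ. Qed.

Lemma adjmx1 n : (1%:M : 'M[C]_n) ^t* = 1%:M.
Proof. by rewrite trmx1 map_mx1. Qed.

(** The trace is the squared Frobenius norm of [M], so matrix identities can be checked by a trace
    computation. *)
Lemma mxtrace_mul_adj_eq0 m n (M : 'M[C]_(m, n)) :
  \tr (M *m M ^t*) = 0 -> M = 0.
Proof.
have trE : \tr (M *m M ^t*) = \sum_i \sum_j `|M i j| ^+ 2.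
  apply: eq_bigr => i _; rewrite mxE; apply: eq_bigr => j _.
  by rewrite adjmxE normCK.
rewrite trE => /eqP; rewrite psumr_eq0; last first.
  by move=> i _; apply: sumr_ge0 => j _; rewrite exprn_ge0.
move=> /allP M0; apply/matrixP => i j; rewrite [RHS]mxE.
have := M0 i (mem_index_enum i); rewrite psumr_eq0 => [/allP Mi0|k _]; last first.
  by rewrite exprn_ge0.
have := Mi0 j (mem_index_enum j).
by rewrite expf_eq0 normr_eq0 /= => /eqP.
Qed.

(** With [H = M M^*] and [D = H M - a M], reality of [a] gives [D D^* = (H^2 - a H)(H - a) = 0],
    hence [D = 0]. This lets a flat spectrum pass from [M M^*] to [M^* M]. *)
Lemma mul_adj_eq_scale m n (a : C) (M : 'M[C]_(m, n)) : a \is Num.real ->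
  (M *m M ^t*) *m (M *m M ^t*) = a *: (M *m M ^t*) ->
  (M *m M ^t*) *m M = a *: M.
Proof.
move=> aR H; set H0 := M *m M ^t* in H *.
have Hadj : H0 ^t* = H0 by rewrite /H0 adjmxM trmxCK.
apply/eqP; rewrite -subr_eq0; apply/eqP/mxtrace_mul_adj_eq0.
have -> : (H0 *m M - a *: M) ^t* = M ^t* *m (H0 - a%:M).
  rewrite adjmxD -scaleN1r !adjmxZ adjmxM Hadj rmorphN1 scaleN1r (CrealP aR).
  by rewrite mulmxBr mul_mx_scalar.
rewrite mulmxA [X in X *m _]mulmxBl -mulmxA -scalemxAl -/H0 H subrr mul0mx.
exact: mxtrace0.
Qed.

Definition is_projmx n (M : 'M[C]_n) := M ^t* = M /\ M *m M = M.

Lemma projmxM n (M N : 'M[C]_n) :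
  is_projmx M -> is_projmx N -> M *m N = N *m M -> is_projmx (M *m N).
Proof.
move=> [hM MM] [hN NN] MN; split; first by rewrite adjmxM hM hN.
by rewrite -mulmxA (mulmxA N) -MN -(mulmxA M) NN mulmxA MM.
Qed.

Lemma projmx_prod n (T : eqType) (h : T -> 'M[C]_n) (r : seq T) :
  {in r, forall d, is_projmx (h d)} ->
  {in r &, forall d e, h d *m h e = h e *m h d} ->
  is_projmx (\prod_(d <- r) h d).
Proof.
elim: r => [|d r IH] hp hc; first by rewrite big_nil; split; rewrite ?adjmx1 ?mulmx1.
rewrite big_cons; apply: projmxM.
- exact/hp/mem_head.
- by apply: IH => [e er|e f er fr]; [apply: hp|apply: hc]; rewrite inE ?er ?fr orbT.
- have: {in r, forall e, h d *m h e = h e *m h d}.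
    by move=> e er; apply: hc; rewrite inE ?eqxx ?er ?orbT.
  elim: r {IH hp hc} => [|e r IH] hd; first by rewrite big_nil mulmx1 mul1mx.
  rewrite big_cons [h e * _]/(h e *m _) mulmxA hd ?mem_head // -!mulmxA IH //.
  by move=> f fr; apply: hd; rewrite inE fr orbT.
Qed.

(* The difference of the two sides is a projection of trace zero. *)
Lemma projmx_rank1 n (P : 'M[C]_n) (v : 'cV[C]_n) :
  is_projmx P -> P *m v = v -> \tr P = 1 -> \sum_x `|v x 0| ^+ 2 = 1 ->
  v *m v ^t* = P.
Proof.
move=> [hP PP] Pv trP nv.
have vv : v ^t* *m v = 1%:M.
  apply/matrixP => i j; rewrite !ord1 !mxE eqxx -[RHS]nv.
  by apply: eq_bigr => x _; rewrite adjmxE normCKC.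
have Pv' : v ^t* *m P = v ^t* by rewrite -{1}hP -adjmxM Pv.
set Q := v *m v ^t*.
have QQ : Q *m Q = Q by rewrite /Q -mulmxA (mulmxA _ v) vv mul1mx.
have PQ : P *m Q = Q by rewrite /Q mulmxA Pv.
have QP : Q *m P = Q by rewrite /Q -mulmxA Pv'.
have hQ : Q ^t* = Q by rewrite /Q adjmxM trmxCK.
apply/eqP; rewrite eq_sym -subr_eq0; apply/eqP/mxtrace_mul_adj_eq0.
rewrite adjmxD -scaleN1r adjmxZ rmorphN1 hP hQ scaleN1r.
rewrite mulmxBl !mulmxBr PP PQ QP QQ subrr subr0 linearB /= trP.
by rewrite /Q mxtrace_mulC vv mxtrace1 subrr.
Qed.

End Adjoint.

(** * Entropy of a flat spectrum *)

Section FlatEntropy.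
Variable R : realType.
Local Notation C := R[i].

(** Every eigenvalue [d] satisfies [d^2 = k d], so it is [0] or [k]; as the eigenvalues sum to 1,
    those equal to [k] carry total weight 1. *)
Lemma entropy_flat n (M : 'M[C]_n) (k : R) :
  M ^t* = M -> M *m M = k%:C *: M -> \tr M = 1 -> entropy M = (- ln k)%:C.
Proof.
move=> hM MM trM.
have nM : M \is normalmx by apply/normalmxP; rewrite hM.
have := orthomx_spectralP nM.
set U := spectralmx M; set D := spectral_diag M => ME.
have Uu : U \in unitmx := spectral_unit M.
have DE : diag_mx D = U *m M *m invmx U.
  by rewrite [in RHS]ME !mulmxA mulmxV // mul1mx mulmxK.
have DD : diag_mx D *m diag_mx D = k%:C *: diag_mx D.
  rewrite DE !mulmxA mulmxKV //.
  by rewrite -(mulmxA U M M) MM -scalemxAr -scalemxAl.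
have trD : \sum_i D 0 i = 1.
  by rewrite -mxtrace_diag DE mxtrace_mulC mulmxA mulVmx // mul1mx.
have D01 i : D 0 i = 0 \/ D 0 i = k%:C.
  move/matrixP/(_ i i): DD; rewrite mul_diag_mx !mxE eqxx mulr1n => /eqP.
  rewrite -subr_eq0 -mulrBl mulf_eq0 subr_eq0.
  by case/orP => /eqP ->; [right|left].
rewrite /entropy /mxlog -/U -/D {1}ME -mulmxA !mulmxA mulmxK //.
rewrite mxtrace_mulC !mulmxA mulmxV // mul1mx mulmx_diag mxtrace_diag rmorphN /=.
(* Writing [ln k] as the sum of the [D_i ln k] allows a termwise comparison, in which a zero
   eigenvalue kills both sides. *)
congr (- _); rewrite -[RHS]mul1r -trD mulr_suml; apply: eq_bigr => i _.
by rewrite !mxE; case: (D01 i) => ->; rewrite ?mul0r.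
Qed.

End FlatEntropy.

(** * Tensor products of 2 by 2 matrices *)

Section Tensor.
Variable R : realType.
Local Notation C := R[i].

(** The index type [I] is arbitrary so that one construction serves the whole chain, [spins L], and
    its parts, [config A]. *)
Definition tensor (I : finType) (f : I -> 'M[C]_2) :
    'M[C]_#|{: {ffun I -> 'I_2}}| :=
  \matrix_(a, b) \prod_i f i ((enum_val a : {ffun I -> 'I_2}) i)
                            ((enum_val b : {ffun I -> 'I_2}) i).

Lemma tensorE (I : finType) (f : I -> 'M[C]_2) (x y : {ffun I -> 'I_2}) :
  tensor f (enum_rank x) (enum_rank y) = \prod_i f i (x i) (y i).
Proof. by rewrite mxE !enum_rankK. Qed.

Lemma rank_matrixP (S T : finType) (M N : 'M[C]_(#|S|, #|T|)) :
  (forall x y, M (enum_rank x) (enum_rank y) = N (enum_rank x) (enum_rank y)) ->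
  M = N.
Proof.
by move=> MN; apply/matrixP => a b; rewrite -(enum_valK a) -(enum_valK b) MN.
Qed.

Lemma mulmx_rankE (S : finType) m n (M : 'M[C]_(m, #|S|)) (N : 'M[C]_(#|S|, n)) i j :
  (M *m N) i j = \sum_(z : S) M i (enum_rank z) * N (enum_rank z) j.
Proof.
rewrite mxE (reindex_onto (@enum_rank S) enum_val) => [|a _]; last exact: enum_valK.
by apply: eq_bigl => z; rewrite enum_rankK eqxx.
Qed.

Lemma mxtrace_rankE (S : finType) (M : 'M[C]_#|S|) :
  \tr M = \sum_(z : S) M (enum_rank z) (enum_rank z).
Proof.
rewrite /mxtrace (reindex_onto (@enum_rank S) enum_val) => [|a _]; last exact: enum_valK.
by apply: eq_bigl => z; rewrite enum_rankK eqxx.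
Qed.

Lemma scalar_rankE (S : finType) (c : C) (x y : S) :
  (c%:M : 'M[C]_#|S|) (enum_rank x) (enum_rank y) = c *+ (x == y).
Proof. by rewrite mxE (inj_eq enum_rank_inj). Qed.

Lemma tensor_mul (I : finType) (f g : I -> 'M[C]_2) :
  tensor f *m tensor g = tensor (fun i => f i *m g i).
Proof.
apply: rank_matrixP => x y; rewrite mulmx_rankE tensorE.
under [RHS]eq_bigr do rewrite mxE.
(* Expanding the product of sums, a choice of middle index at each site becomes one middle
   configuration [z]. *)
rewrite bigA_distr_bigA; apply: eq_bigr => z _.
by rewrite !tensorE -big_split.
Qed.

Lemma eq_tensor (I : finType) (f g : I -> 'M[C]_2) : f =1 g -> tensor f = tensor g.
Proof.
by move=> fg; apply: rank_matrixP => x y; rewrite !tensorE; apply: eq_bigr => i _; rewrite fg.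
Qed.

Lemma prod_eqb (I : finType) (x y : {ffun I -> 'I_2}) :
  \prod_i ((x i == y i)%:R : C) = (x == y)%:R.
Proof.
rewrite -natr_prod; congr (_%:R); case: eqVneq => [->|xy].
  by rewrite big1 // => i _; rewrite eqxx.
have [i xyi] : exists i, x i != y i.
  apply/existsP; rewrite -negb_forall; apply: contra xy => /forallP xy.
  by apply/eqP/ffunP => i; apply/eqP.
by rewrite (bigD1 i) //= (negPf xyi) mul0n.
Qed.

Lemma tensor1 (I : finType) : tensor (fun _ : I => 1%:M) = 1%:M.
Proof.
apply: rank_matrixP => x y; rewrite tensorE scalar_rankE -mulr_natr mul1r -prod_eqb.
by apply: eq_bigr => i _; rewrite mxE.
Qed.

Lemma tensor_scale (I : finType) (c : I -> C) (f : I -> 'M[C]_2) :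
  tensor (fun i => c i *: f i) = (\prod_i c i) *: tensor f.
Proof.
apply: rank_matrixP => x y; rewrite [RHS]mxE !tensorE -big_split.
by apply: eq_bigr => i _; rewrite mxE.
Qed.

Lemma tensor_adj (I : finType) (f : I -> 'M[C]_2) :
  (tensor f) ^t* = tensor (fun i => (f i) ^t*).
Proof.
apply: rank_matrixP => x y; rewrite adjmxE !tensorE rmorph_prod.
by apply: eq_bigr => i _; rewrite adjmxE.
Qed.

Lemma tensor_prod (I J : finType) (P : pred J) (r : seq J) (f : J -> I -> 'M[C]_2) :
  \prod_(j <- r | P j) tensor (f j) = tensor (fun i => \prod_(j <- r | P j) f j i).
Proof.
elim: r => [|j r IH].
  by rewrite big_nil -[LHS]tensor1; apply: eq_tensor => i; rewrite big_nil.
rewrite big_cons; under [in RHS]eq_tensor do rewrite big_cons.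
by case: (P j) => //; rewrite IH -tensor_mul.
Qed.

End Tensor.

(** * Pauli strings, Majorana operators and their commutation signs *)

Section Pauli.
Variable R : realType.
Local Notation C := R[i].

(** Carrying the sign as a boolean makes commutation additive over [F_2]: parities add under matrix
    products and over tensor factors. *)
Definition sign_commute n (b : bool) (M N : 'M[C]_n) :=
  M *m N = (-1) ^+ b *: (N *m M).

Lemma sign_commuteZ n b (M N : 'M[C]_n) a :
  sign_commute b M N -> sign_commute b M (a *: N).
Proof. by move=> MN; rewrite /sign_commute -scalemxAr MN scalerA mulrC -scalerA scalemxAl. Qed.

Lemma sign_commute_sym n b (M N : 'M[C]_n) :
  sign_commute b M N -> sign_commute b N M.
Proof. by move=> MN; rewrite /sign_commute MN scalerA -signr_addb addbb scale1r. Qed.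

Lemma sign_commuteM n b c (M N Q : 'M[C]_n) :
  sign_commute b M N -> sign_commute c M Q -> sign_commute (b (+) c) M (N *m Q).
Proof.
move=> MN MQ; rewrite /sign_commute mulmxA MN -scalemxAl -mulmxA MQ -scalemxAr.
by rewrite scalerA signr_addb mulmxA.
Qed.

Lemma sign_commute_prod n (T : eqType) (r : seq T) (b : T -> bool) M (N : T -> 'M[C]_n) :
  {in r, forall d, sign_commute (b d) M (N d)} ->
  sign_commute (\big[addb/false]_(d <- r) b d) M (\prod_(d <- r) N d).
Proof.
elim: r => [|d r IH] H.
  by rewrite !big_nil /sign_commute mulmx1 mul1mx expr0 scale1r.
rewrite !big_cons; apply: sign_commuteM; first exact/H/mem_head.
by apply: IH => e er; apply: H; rewrite inE er orbT.
Qed.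

Lemma sign_commute_tensor (I : finType) (b : I -> bool) (f g : I -> 'M[C]_2) :
  (forall i, sign_commute (b i) (f i) (g i)) ->
  sign_commute (\big[addb/false]_i b i) (tensor f) (tensor g).
Proof.
move=> H; rewrite /sign_commute !tensor_mul (eq_tensor H).
rewrite (tensor_scale (fun i => (-1) ^+ b i)); congr (_ *: _).
by elim/big_rec2: _ => // i c y _ ->; rewrite signr_addb.
Qed.

(* X^a Z^b up to a phase is encoded by the pair (a, b). *)
Definition pauli (q : bool * bool) : 'M[C]_2 :=
  match q with
  | (false, false) => 1%:M
  | (false, true) => sigma_z R
  | (true, false) => sigma_x R
  | (true, true) => sigma_y R
  end.

(** The symplectic form on [F_2^2], which decides whether two Pauli matrices anticommute. *)
Definition pauli_form (q r : bool * bool) : bool := (q.1 && r.2) (+) (q.2 && r.1).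

Lemma pauli_formC q r : pauli_form q r = pauli_form r q.
Proof. by case: q r => [[] []] [[] []]. Qed.

Lemma pauli_sign_commute q r : sign_commute (pauli_form q r) (pauli q) (pauli r).
Proof.
rewrite /sign_commute; case: q r => [[] []] [[] []] /=;
  rewrite /pauli_form /= ?expr0 ?expr1 ?scale1r ?scaleN1r ?mulmx1 ?mul1mx //;
  apply/matrixP => -[[|[|//]] ?] [[|[|//]] ?];
  by rewrite !mxE !big_ord_recl !big_ord0 !mxE /=
    ?(mulr0, mul0r, add0r, addr0, mulr1, mul1r, mulrN1, mulN1r, oppr0, opprK, mulrN, mulNr).
Qed.

Lemma pauli_sqr q : pauli q *m pauli q = 1%:M.
Proof.
case: q => [[] []] /=; rewrite ?mulmx1 //;
  apply/matrixP => -[[|[|//]] ?] [[|[|//]] ?];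
  by rewrite !mxE !big_ord_recl !big_ord0 !mxE /=
    ?(mulr0, mul0r, add0r, addr0, mulr1, mul1r, mulrN1, mulN1r, oppr0, opprK,
      mulrN, mulNr) -?expr2 ?sqrCi ?opprK.
Qed.

Lemma pauli_adj q : (pauli q) ^t* = pauli q.
Proof.
case: q => [[] []] /=; rewrite ?adjmx1 //;
  apply/matrixP => -[[|[|//]] ?] [[|[|//]] ?];
  by rewrite adjmxE !mxE /= ?(conjC0, conjC1, rmorphN) /= ?(conjCi, conjC1) ?opprK.
Qed.

Definition pauli_string (I : finType) (w : I -> bool * bool) :=
  tensor (fun i => pauli (w i)).

Lemma pauli_string_sqr (I : finType) (w : I -> bool * bool) :
  pauli_string w *m pauli_string w = 1%:M.
Proof. by rewrite tensor_mul -tensor1; apply: eq_tensor => i; rewrite pauli_sqr. Qed.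

Lemma pauli_string_adj (I : finType) (w : I -> bool * bool) :
  (pauli_string w) ^t* = pauli_string w.
Proof. by rewrite tensor_adj; apply: eq_tensor => i; rewrite pauli_adj. Qed.

Lemma pauli_string_sign_commute (I : finType) (v w : I -> bool * bool) :
  sign_commute (\big[addb/false]_i pauli_form (v i) (w i))
    (pauli_string v) (pauli_string w).
Proof. by apply: sign_commute_tensor => i; apply: pauli_sign_commute. Qed.

Lemma on_site_tensor L (k : 'I_L) (P : 'M[C]_2) :
  on_site k P = tensor (fun i => if i == k then P else 1%:M).
Proof.
apply: (@rank_matrixP R (spins L) (spins L)) => s t.
rewrite (tensorE _ (s : spins L) t) mxE !enum_rankK /=.
case: ifPn => [/forallP st|].
  rewrite (bigD1 k) //= eqxx big1 ?mulr1 // => i ik; rewrite (negPf ik) mxE.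
  by have := st i; rewrite ik /= => ->.
rewrite negb_forall; case/existsP => i; rewrite negb_imply => /andP[ik st].
by rewrite (bigD1 i) //= (negPf ik) mxE (negPf st) mul0r.
Qed.

(** The Jordan-Wigner string of a mode, as a Pauli label for each site. *)
Definition mode_pauli L (j : 'I_(2 * L)) (i : 'I_L) : bool * bool :=
  if (i < site j)%N then (false, true)
  else if i == site j then (true, odd j) else (false, false).

Lemma majoranaE L (j : 'I_(2 * L)) : majorana R j = pauli_string (mode_pauli j).
Proof.
rewrite /majorana on_site_tensor.
under eq_bigr do rewrite on_site_tensor.
rewrite tensor_prod tensor_mul; apply: eq_tensor => i.
rewrite /mode_pauli; case: (boolP (i < site j)%N) => ij.
  rewrite (@big_only1 _ _ _ _ i _ _ ij) ?eqxx => [|k ki _]; last by rewrite eq_sym (negPf ki).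
  by rewrite ifF ?mulmx1 //; apply/negbTE; rewrite neq_ltn ij.
rewrite big1 ?mul1mx => [|k kj]; first by case: eqP => //; case: (odd j).
by rewrite ifF //; apply: contraNF ij => /eqP ->.
Qed.

(** Only the site of the earlier mode contributes. To its left both strings have Z, to its right one
    string is trivial; on it, X or Y meets the Z of a later string, or X meets Y if both modes share
    the site. *)
Lemma majorana_form L (j k : 'I_(2 * L)) : j != k ->
  \big[addb/false]_i pauli_form (mode_pauli j i) (mode_pauli k i) = true.
Proof.
wlog jk : j k / (site j <= site k)%N => [H|] jNk.
  case/orP: (leq_total (site j) (site k)) => jk; first exact: H.
  under eq_bigr do rewrite pauli_formC; by apply: H; rewrite // eq_sym.
rewrite (@big_only1 _ _ _ _ (site j)) // => [|i ij _].
  rewrite /mode_pauli ltnn eqxx; case: ltngtP jk => //= jk _.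
    by rewrite /pauli_form /= andbF.
  rewrite ifT; last by apply/eqP/val_inj.
  rewrite /pauli_form /= andbT; apply: contraNT jNk => jk'.
  apply/eqP/val_inj; rewrite /= -(odd_double_half j) -(odd_double_half k).
  by move: jk jk' => /= ->; case: (odd j); case: (odd k).
rewrite /mode_pauli (negPf ij); case: ifP => // ij'.
by rewrite (leq_trans ij' jk).
Qed.

Lemma majorana_anticommute L (j k : 'I_(2 * L)) : j != k ->
  sign_commute true (majorana R j) (majorana R k).
Proof.
by move=> jk; rewrite !majoranaE -(majorana_form jk); apply: pauli_string_sign_commute.
Qed.

Lemma majorana_sqr L (j : 'I_(2 * L)) : majorana R j *m majorana R j = 1%:M.
Proof. by rewrite majoranaE pauli_string_sqr. Qed.

Lemma majorana_adj L (j : 'I_(2 * L)) : (majorana R j) ^t* = majorana R j.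
Proof. by rewrite majoranaE pauli_string_adj. Qed.

(** These operators serve as probes: anticommuting with one of them outside [A] forces a partial
    trace to vanish. *)
Definition site_pauli L (k : 'I_L) (q : bool * bool) : 'M[C]_#|spins L| :=
  pauli_string (fun i => if i == k then q else (false, false)).

Lemma site_pauli_majorana L (k : 'I_L) q (j : 'I_(2 * L)) :
  sign_commute (pauli_form q (mode_pauli j k)) (site_pauli k q) (majorana R j).
Proof.
rewrite majoranaE /site_pauli.
have -> : pauli_form q (mode_pauli j k) = \big[addb/false]_i
    pauli_form (if i == k then q else (false, false)) (mode_pauli j i).
  by rewrite (@big_only1 _ _ _ _ (k)) ?eqxx // => i ik _; rewrite (negPf ik).
exact: pauli_string_sign_commute.
Qed.

(* With q the other of X and Y, resp. the last factor of gamma_j, a site Pauli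
   anticommutes among the modes up to j only with j itself, resp. among the
   modes from j on with all but j. *)
Lemma form_above L (j j' : 'I_(2 * L)) : (j' <= j)%N ->
  pauli_form (true, ~~ odd j) (mode_pauli j' (site j)) = (j' == j).
Proof.
move=> jj; rewrite /mode_pauli -val_eqE -[RHS]val_eqE /pauli_form /=.
by case: ltngtP => ?; case: eqP => ? /=; lia.
Qed.

Lemma form_below L (j j' : 'I_(2 * L)) : (j <= j')%N ->
  pauli_form (true, odd j) (mode_pauli j' (site j)) = (j' != j).
Proof.
move=> jj; rewrite /mode_pauli -val_eqE -[in RHS]val_eqE /pauli_form /=.
by case: ltngtP => ?; case: eqP => ? /=; lia.
Qed.

End Pauli.

(** * Partial traces and the Schmidt matrix *)

Section PartialTrace.
Variables (R : realType) (L : nat).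
Local Notation C := R[i].
Implicit Types (A : {set 'I_L}) (M : 'M[C]_#|spins L|).

(** The default [ord0] is never reached, since each site lies in [A] or in its complement. *)
Definition glue A (a : config A) (e : config (~: A)) : spins L :=
  [ffun i => if insub i is Some u then a u
             else if insub i is Some v then e v else ord0].

Lemma glue_in A (a : config A) e (u : {i | i \in A}) : glue a e (val u) = a u.
Proof. by rewrite ffunE valK. Qed.

Lemma glue_out A (a : config A) e (v : {i | i \in ~: A}) : glue a e (val v) = e v.
Proof.
by rewrite ffunE insubN ?valK //; have := valP v; rewrite inE.
Qed.

Lemma restr_glue A (a : config A) e : restr A (glue a e) = a.
Proof. by apply/ffunP => u; rewrite ffunE glue_in. Qed.

Lemma restrC_glue A (a : config A) e : restr (~: A) (glue a e) = e.
Proof. by apply/ffunP => u; rewrite ffunE glue_out. Qed.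

Lemma glue_restr A (x : spins L) : glue (restr A x) (restr (~: A) x) = x.
Proof.
apply/ffunP => i; rewrite ffunE; case: insubP => [u _ <-|iA]; first by rewrite ffunE.
by case: insubP => [v _ <-|]; rewrite ?ffunE // inE (negPf iA).
Qed.

Lemma sum_glue (V : nmodType) A (F : spins L -> V) :
  \sum_x F x = \sum_(a : config A) \sum_(e : config (~: A)) F (glue a e).
Proof.
rewrite pair_bigA /= (reindex (fun q : config A * config (~: A) => glue q.1 q.2)) //.
exists (fun x => (restr A x, restr (~: A) x)) => [[a e] _|x _] /=.
  by rewrite restr_glue restrC_glue.
exact: glue_restr.
Qed.

Lemma sum_restr (V : nmodType) A (a : config A) (F : spins L -> V) :
  \sum_(x | restr A x == a) F x = \sum_e F (glue a e).
Proof.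
rewrite big_mkcond (sum_glue A) (bigD1 a) //= [X in _ + X]big1 ?addr0 => [|b ba].
  by apply: eq_bigr => e _; rewrite restr_glue eqxx.
by rewrite big1 // => e _; rewrite restr_glue (negPf ba).
Qed.

Lemma sum_restrC (V : nmodType) A (e : config (~: A)) (F : spins L -> V) :
  \sum_(x | restr (~: A) x == e) F x = \sum_a F (glue a e).
Proof.
rewrite big_mkcond (sum_glue A); apply: eq_bigr => a _.
rewrite (bigD1 e) //= restrC_glue eqxx big1 ?addr0 // => f fe.
by rewrite restrC_glue (negPf fe).
Qed.

Lemma ptraceE A M (a b : config A) :
  ptrace A M (enum_rank a) (enum_rank b)
    = \sum_e M (enum_rank (glue a e)) (enum_rank (glue b e)).
Proof.
rewrite mxE !enum_rankK sum_restr; apply: eq_bigr => e _.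
rewrite big_mkcondr sum_restr (bigD1 e) //= !restrC_glue eqxx big1 ?addr0 // => f fe.
by rewrite !restrC_glue (negPf fe).
Qed.

Lemma mxtrace_ptrace A M : \tr (ptrace A M) = \tr M.
Proof.
by rewrite !mxtrace_rankE (sum_glue A); apply: eq_bigr => a _; rewrite ptraceE.
Qed.

Lemma ptraceD A M N : ptrace A (M + N) = ptrace A M + ptrace A N.
Proof.
apply: rank_matrixP => a b; rewrite [RHS]mxE !ptraceE -big_split.
by apply: eq_bigr => e _; rewrite mxE.
Qed.

Lemma ptraceZ A c M : ptrace A (c *: M) = c *: ptrace A M.
Proof.
apply: rank_matrixP => a b; rewrite [RHS]mxE !ptraceE mulr_sumr.
by apply: eq_bigr => e _; rewrite mxE.
Qed.

Lemma ptrace_adj A M : (ptrace A M) ^t* = ptrace A (M ^t*).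
Proof.
apply: rank_matrixP => a b; rewrite adjmxE !ptraceE rmorph_sum.
by apply: eq_bigr => e _; rewrite adjmxE.
Qed.

Lemma ptrace1 A : ptrace A (1%:M : 'M[C]_#|spins L|) = (2 ^ #|~: A|)%:R%:M.
Proof.
apply: rank_matrixP => a b; rewrite ptraceE scalar_rankE.
under eq_bigr do rewrite scalar_rankE.
have -> : (2 ^ #|~: A| = #|config (~: A)|)%N.
  by rewrite card_ffun card_ord card_sig.
case: (eqVneq a b) => [->|ab].
  by under eq_bigr do rewrite eqxx; rewrite sumr_const mulr1n.
rewrite mulr0n big1 // => e _; case: eqVneq => // /(congr1 (restr A)).
by rewrite !restr_glue => /eqP; rewrite (negPf ab).
Qed.

Lemma tensor_glue A (f : 'I_L -> 'M[C]_2) (a b : config A) e e' :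
  tensor f (enum_rank (glue a e)) (enum_rank (glue b e'))
    = tensor (fun u : {i | i \in A} => f (val u)) (enum_rank a) (enum_rank b)
      * tensor (fun u : {i | i \in ~: A} => f (val u)) (enum_rank e) (enum_rank e').
Proof.
rewrite !tensorE (bigID (mem A)) /= big_sub; congr (_ * _).
  by apply: eq_bigr => u _; rewrite !glue_in.
rewrite (eq_bigl (mem (~: A))) => [|i]; last by rewrite !inE.
by rewrite big_sub; apply: eq_bigr => u _; rewrite !glue_out.
Qed.

(** The factor of [tensor f] on the environment is the identity, so only equal environment labels
    survive. *)
Lemma ptrace_tensorM_in A (f : 'I_L -> 'M[C]_2) M :
  (forall i, i \notin A -> f i = 1%:M) ->
  ptrace A (tensor f *m M)
    = tensor (fun u : {i | i \in A} => f (val u)) *m ptrace A M.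
Proof.
move=> f1; have fC : tensor (fun u : {i | i \in ~: A} => f (val u)) = 1%:M.
  by rewrite -tensor1; apply: eq_tensor => u; apply: f1; have := valP u; rewrite inE.
apply: rank_matrixP => a b; rewrite ptraceE mulmx_rankE.
under [RHS]eq_bigr do rewrite ptraceE mulr_sumr.
rewrite exchange_big; apply: eq_bigr => e _.
rewrite mulmx_rankE (sum_glue A); apply: eq_bigr => c _.
rewrite (bigD1 e) //= tensor_glue fC scalar_rankE eqxx mulr1 big1 ?addr0 // => e' ee'.
by rewrite tensor_glue fC scalar_rankE eq_sym (negPf ee') mulr0 mul0r.
Qed.

(** Cyclicity of the trace, valid for the partial trace when the operator acts on the traced-out
    sites only. *)
Lemma ptrace_tensorM_out A (f : 'I_L -> 'M[C]_2) M :
  (forall i, i \in A -> f i = 1%:M) ->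
  ptrace A (tensor f *m M) = ptrace A (M *m tensor f).
Proof.
move=> f1; have fA : tensor (fun u : {i | i \in A} => f (val u)) = 1%:M.
  by rewrite -tensor1; apply: eq_tensor => u; apply: f1; apply: valP.
apply: rank_matrixP => a b; rewrite !ptraceE.
pose g := tensor (fun u : {i | i \in ~: A} => f (val u)).
(* Both orders of multiplication give this sum, the second one after exchanging [e] and [e']. *)
transitivity (\sum_e \sum_e' g (enum_rank e) (enum_rank e')
                * M (enum_rank (glue a e')) (enum_rank (glue b e))).
  apply: eq_bigr => e _; rewrite mulmx_rankE (sum_glue A) exchange_big.
  apply: eq_bigr => e' _; rewrite (bigD1 a) //= tensor_glue fA scalar_rankE eqxx.
  rewrite mulr1n mul1r big1 ?addr0 // => c ca.
  by rewrite tensor_glue fA scalar_rankE eq_sym (negPf ca) mulr0n !mul0r.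
rewrite exchange_big; apply: eq_bigr => e _; rewrite mulmx_rankE (sum_glue A) exchange_big.
apply: eq_bigr => e' _; rewrite (bigD1 b) //= tensor_glue fA scalar_rankE eqxx.
rewrite mulr1n mul1r mulrC big1 ?addr0 // => c ca.
by rewrite tensor_glue fA scalar_rankE (negPf ca) mulr0n mul0r mulr0.
Qed.

(** The probe [u] squares to 1 and moves cyclically, so the partial traces of [M = u u M], of
    [u M u] and of [- M u u = - M] agree. *)
Lemma ptrace_sign_commute_eq0 A (k : 'I_L) q M :
  k \notin A -> sign_commute true (site_pauli R k q) M -> ptrace A M = 0.
Proof.
move=> kA uM; set u := site_pauli R k q in uM.
have MuE : M = u *m (u *m M) by rewrite mulmxA pauli_string_sqr mul1mx.
have : ptrace A M = - ptrace A M.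
  rewrite {1}MuE ptrace_tensorM_out; last first.
    by move=> i iA; rewrite ifF //; apply: contraNF kA => /eqP <-.
  rewrite -[tensor _]/u uM expr1 scaleN1r mulNmx -mulmxA pauli_string_sqr mulmx1.
  by rewrite -scaleN1r ptraceZ scaleN1r.
move/eqP; rewrite -addr_eq0 -mulr2n -scaler_nat scaler_eq0 pnatr_eq0 /=.
by move/eqP.
Qed.

Definition schmidt_mx A (psi : 'cV[C]_#|spins L|) : 'M[C]_(#|config A|, #|config (~: A)|) :=
  \matrix_(a, e) psi (enum_rank (glue (enum_val a) (enum_val e))) 0.

Lemma schmidt_mxE A psi (a : config A) e :
  schmidt_mx A psi (enum_rank a) (enum_rank e) = psi (enum_rank (glue a e)) 0.
Proof. by rewrite mxE !enum_rankK. Qed.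

Lemma ketbraE (psi : 'cV[C]_#|spins L|) x y :
  (psi *m psi ^t*) x y = psi x 0 * (psi y 0)^*%R.
Proof. by rewrite mxE big_ord1 adjmxE. Qed.

Lemma ptrace_ketbra A psi :
  ptrace A (psi *m psi ^t*) = schmidt_mx A psi *m (schmidt_mx A psi) ^t*.
Proof.
apply: rank_matrixP => a b; rewrite ptraceE mulmx_rankE; apply: eq_bigr => e _.
by rewrite ketbraE adjmxE !schmidt_mxE.
Qed.

Lemma ptraceC_ketbra A psi :
  ptrace (~: A) (psi *m psi ^t*) = ((schmidt_mx A psi) ^t* *m schmidt_mx A psi)^T.
Proof.
(* The definition is unfolded here because [ptraceE] would label the environment by
   [config (~: ~: A)] instead of [config A]. *)
apply: rank_matrixP => e f; rewrite [RHS]mxE mxE !enum_rankK sum_restrC mulmx_rankE.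
apply: eq_bigr => a _; rewrite big_mkcondr sum_restrC (bigD1 a) //= setCK.
rewrite !restr_glue eqxx big1 => [|b ba]; last by rewrite !restr_glue (negPf ba).
by rewrite addr0 ketbraE adjmxE !schmidt_mxE mulrC.
Qed.

End PartialTrace.

(** * Counting modes and dimers *)

Section DimerPartition.
Variables (L : nat) (Omega : {set 'I_(2 * L) * 'I_(2 * L)}).
Hypothesis Omega_dimer : dimer_partition Omega.

Lemma card_dimers : #|Omega| = L.
Proof. by case/and3P: Omega_dimer => /eqP. Qed.

Lemma dimer_lt d : d \in Omega -> (d.1 < d.2)%N.
Proof. by case/and3P: Omega_dimer => _ /forall_inP H _; apply: H. Qed.

Lemma dimer_neq d : d \in Omega -> d.1 != d.2.
Proof. by move/dimer_lt; rewrite -val_eqE neq_ltn => ->. Qed.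

(** The order of the two ends recovers the pair from the unordered set. *)
Lemma dimer_set_inj :
  {in Omega &, injective (fun d : 'I_(2 * L) * 'I_(2 * L) => [set d.1; d.2])}.
Proof.
move=> d e /dimer_lt dlt /dimer_lt elt /setP de.
have: ((d.1 == e.1) || (d.1 == e.2)) && ((d.2 == e.1) || (d.2 == e.2)).
  by have := de d.1; have := de d.2; rewrite !inE !eqxx orbT => <- <-.
case: d e dlt elt {de} => [[d1 ?] [d2 ?]] [[e1 ?] [e2 ?]] /= dlt elt.
rewrite -!val_eqE /= => H; have [e1E e2E] : d1 = e1 /\ d2 = e2 by lia.
by congr (_, _); apply: val_inj.
Qed.

Lemma dimers_disjoint d e : d \in Omega -> e \in Omega -> d != e ->
  [disjoint [set d.1; d.2] & [set e.1; e.2]].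
Proof.
move=> dO eO de; case/and3P: Omega_dimer => _ _ /and3P[_ /trivIsetP tI _].
apply: tI; [by apply/imsetP; exists d|by apply/imsetP; exists e|].
by apply: contraNN de => /eqP H; apply/eqP/dimer_set_inj.
Qed.

Lemma sum_dimers (F : 'I_(2 * L) -> nat) :
  (\sum_j F j = \sum_(d in Omega) (F d.1 + F d.2))%N.
Proof.
case/and3P: Omega_dimer => _ _ /and3P[/eqP cov tI _].
transitivity (\sum_(j in cover [set [set d.1; d.2] | d in Omega]) F j)%N.
  by apply: eq_bigl => j; rewrite cov inE.
rewrite big_trivIset // big_imset; last exact: dimer_set_inj.
apply: eq_bigr => d dO; rewrite big_setU1 ?big_set1 //.
by rewrite inE dimer_neq.
Qed.

Lemma card_site (i : 'I_L) : #|[pred j : 'I_(2 * L) | site j == i]| = 2.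
Proof.
have lt0 : (2 * i < 2 * L)%N by have := ltn_ord i; lia.
have lt1 : ((2 * i).+1 < 2 * L)%N by have := ltn_ord i; lia.
rewrite (eq_card (B := mem [set Ordinal lt0; Ordinal lt1])) ?cards2.
  by rewrite -val_eqE /= neq_ltn ltnSn.
by move=> j; rewrite !inE -!val_eqE /=; lia.
Qed.

Definition outer_dimers (A : {set 'I_L}) : {set 'I_(2 * L) * 'I_(2 * L)} :=
  [set d in Omega | ~~ ((site d.1 \in A) && (site d.2 \in A))].

(** Count the modes outside [A]. There are two per site; grouped by dimers, an outer dimer has two
    of them, or one if it crosses. *)
Lemma card_outer_dimers A :
  (2 * #|outer_dimers A| = 2 * #|~: A| + #|crossing_dimers Omega A|)%N.
Proof.
have -> : (2 * #|~: A| = \sum_(j : 'I_(2 * L)) (site j \in ~: A))%N.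
  rewrite (partition_big (@site L) predT) //= -sum1_card big_distrr /= [LHS]big_mkcond.
  apply: eq_bigr => i _.
  rewrite [RHS](eq_bigr (fun=> (i \in ~: A) : nat)) => [|j /eqP -> //].
  by rewrite sum_nat_const card_site; case: (i \in ~: A).
have cardE (P : pred ('I_(2 * L) * 'I_(2 * L))) :
    #|[set d in Omega | P d]| = (\sum_(d in Omega) P d)%N.
  rewrite -sum1_card [RHS]big_mkcond [LHS]big_mkcond; apply: eq_bigr => d _.
  by rewrite inE; case: (d \in Omega); case: (P d).
rewrite sum_dimers !cardE big_distrr -big_split; apply: eq_bigr => d _ /=.
by rewrite !inE; case: (site d.1 \in A); case: (site d.2 \in A).
Qed.

End DimerPartition.

(** * The stabilizers of the dimers and their partial traces *)

Section Stabilizers.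
Variables (R : realType) (L : nat) (Omega : {set 'I_(2 * L) * 'I_(2 * L)}).
Variable p : 'I_(2 * L) * 'I_(2 * L) -> bool.
Local Notation C := R[i].
Local Notation dimer := ('I_(2 * L) * 'I_(2 * L))%type.
Local Notation op := 'M[C]_#|spins L|.
Hypothesis Omega_dimer : dimer_partition Omega.
Implicit Types (d e : dimer) (A : {set 'I_L}).

Definition dimer_phase d : C := 'i%R * (-1) ^+ p d.

(* Multiplying (gamma_j + i p gamma_k) psi = 0 by gamma_j turns it into the
   eigenvalue equation stab psi = psi. *)
Definition stab d : op := - dimer_phase d *: (majorana R d.1 *m majorana R d.2).

Lemma dimer_phase_sqr d : dimer_phase d * dimer_phase d = -1.
Proof. by rewrite -expr2 exprMn sqrCi sqrr_sign mulr1. Qed.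

Lemma dimer_phase_conj d : (dimer_phase d)^*%R = - dimer_phase d.
Proof. by rewrite rmorphM /= conjCi rmorph_sign mulNr. Qed.

Lemma majorana_anticomm (j k : 'I_(2 * L)) : j != k ->
  majorana R j *m majorana R k = - (majorana R k *m majorana R j).
Proof. by move=> jk; rewrite (majorana_anticommute R jk) expr1 scaleN1r. Qed.

Lemma stab_sqr d : d \in Omega -> stab d *m stab d = 1%:M.
Proof.
move=> /(dimer_neq Omega_dimer) d12; rewrite /stab -scalemxAl -scalemxAr scalerA.
rewrite mulrNN dimer_phase_sqr scaleN1r {1}(majorana_anticomm d12) mulNmx opprK.
by rewrite -mulmxA (mulmxA (majorana R d.1)) majorana_sqr mul1mx majorana_sqr.
Qed.

Lemma stab_adj d : d \in Omega -> (stab d) ^t* = stab d.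
Proof.
move=> /(dimer_neq Omega_dimer) d12; rewrite /stab adjmxZ adjmxM !majorana_adj.
by rewrite rmorphN /= dimer_phase_conj opprK (majorana_anticomm d12) scalerN scaleNr opprK.
Qed.

Lemma stab_sign_commute b c (U : op) d :
  sign_commute b U (majorana R d.1) -> sign_commute c U (majorana R d.2) ->
  sign_commute (b (+) c) U (stab d).
Proof. by move=> U1 U2; apply/sign_commuteZ/sign_commuteM. Qed.

(** Distinct dimers share no mode, so a Majorana operator of one anticommutes with both factors of
    the other, and the two signs cancel. *)
Lemma stab_commute d e : d \in Omega -> e \in Omega ->
  stab d *m stab e = stab e *m stab d.
Proof.
move=> dO eO; case: (eqVneq d e) => [-> //|de].
have dis := dimers_disjoint Omega_dimer dO eO de.
have me j : j \in [set d.1; d.2] -> sign_commute false (majorana R j) (stab e).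
  move=> jd; have := disjointFr dis jd; rewrite !inE => /norP[j1 j2].
  by apply: (@stab_sign_commute true true); apply: majorana_anticommute.
have H : sign_commute (false (+) false) (stab e) (stab d).
  by apply: stab_sign_commute; apply/sign_commute_sym/me; rewrite !inE eqxx ?orbT.
by rewrite H expr0 scale1r.
Qed.

Definition half_stab d : op := 2^-1 *: (1%:M + stab d).

Lemma half_stab_proj d : d \in Omega -> is_projmx (half_stab d).
Proof.
move=> dO; rewrite /half_stab; split.
  by rewrite adjmxZ adjmxD adjmx1 stab_adj // fmorphV rmorph_nat.
rewrite -scalemxAl -scalemxAr scalerA mulmxDl !mulmxDr !mul1mx mulmx1 stab_sqr //.
rewrite (addrC (stab d)) -mulr2n -[X in _ *: X = _]scaler_nat scalerA.
by rewrite mulfVK ?pnatr_eq0.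
Qed.

Lemma half_stab_commute d e : d \in Omega -> e \in Omega ->
  half_stab d *m half_stab e = half_stab e *m half_stab d.
Proof.
move=> dO eO.
have comm1Z (a : C) (U V : op) : U *m V = V *m U ->
    (a *: (1%:M + U)) *m (a *: (1%:M + V)) = (a *: (1%:M + V)) *m (a *: (1%:M + U)).
  move=> UV; rewrite -scalemxAl -scalemxAr mulmxDl !mulmxDr !mul1mx mulmx1 UV.
  rewrite addrACA -[in RHS]scalemxAl -scalemxAr; congr (_ *: (_ *: _)).
  by rewrite mulmxDl !mulmxDr !mul1mx mulmx1.
exact/comm1Z/stab_commute.
Qed.

(** Exactly one dimer of [E] contains [j], at exactly one end. This odd parity is the sign picked up
    by a probe that singles out the mode [j]. *)
Lemma sum_dimer_ends (E : seq dimer) (j : 'I_(2 * L)) :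
  uniq E -> {subset E <= Omega} -> has (fun d => (d.1 == j) || (d.2 == j)) E ->
  \big[addb/false]_(d <- E) ((d.1 == j) (+) (d.2 == j)) = true.
Proof.
move=> uE EO /hasP[d dE dj]; rewrite (bigD1_seq d) //= big_seq_cond big1.
  rewrite addbF; have := dimer_neq Omega_dimer (EO _ dE).
  by case/orP: dj => /eqP <-; rewrite eqxx // eq_sym => /negPf ->.
move=> e /andP[eE ed]; have dis := dimers_disjoint Omega_dimer (EO _ eE) (EO _ dE) ed.
have jd : j \in [set d.1; d.2] by rewrite !inE !(eq_sym j).
by have := disjointFl dis jd; rewrite !inE !(eq_sym j) => /norP[/negPf -> /negPf ->].
Qed.

(** These intervals do not wrap around, which makes Jordan-Wigner strings tractable; [b <= a] gives
    the empty set. *)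
Definition site_interval (a b : nat) : {set 'I_L} := [set i : 'I_L | (a <= i < b)%N].

(* If a mode of E lies right of the interval, the last mode of E does, and a
   Pauli operator on its site anticommutes with the product; on the left one
   uses the first mode, as the number of modes of E is even. *)
Lemma ptrace_stab_prod_eq0 a b (E : seq dimer) :
  E != [::] -> uniq E -> {subset E <= outer_dimers Omega (site_interval a b)} ->
  ptrace (site_interval a b) (\prod_(d <- E) stab d) = 0.
Proof.
set A := site_interval a b => E0 uE EA.
have EO : {subset E <= Omega} by move=> d /EA; rewrite inE => /andP[].
pose P j := has (fun d : dimer => (d.1 == j) || (d.2 == j)) E.
have P1 d : d \in E -> P d.1 by move=> dE; apply/hasP; exists d; rewrite ?eqxx.
have P2 d : d \in E -> P d.2 by move=> dE; apply/hasP; exists d; rewrite ?eqxx ?orbT.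
have [j0 Pj0 j0A] : exists2 j, P j & site j \notin A.
  case: E E0 {uE EO} EA @P P1 P2 => // d E _ EA P P1 P2.
  have dE := mem_head d E; have := EA d dE; rewrite inE negb_and => /andP[_ /orP[]] H.
    by exists d.1; [apply: P1|].
  by exists d.2; [apply: P2|].
(* Here [f] records which modes of [E] anticommute with the probe [q] on the site of [j]. Only the
   parity of [f] over each dimer matters, and it must be that of the indicator of [j]. *)
have key j q (f : 'I_(2 * L) -> bool) : P j -> site j \notin A ->
    (forall j', P j' -> pauli_form q (mode_pauli j' (site j)) = f j') ->
    (forall d, f d.1 (+) f d.2 = (d.1 == j) (+) (d.2 == j)) ->
    ptrace A (\prod_(d <- E) stab d) = 0.
  move=> Pj jA fE fj; apply: (@ptrace_sign_commute_eq0 _ _ _ (site j) q) => //.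
  suff: sign_commute (\big[addb/false]_(d <- E) ((d.1 == j) (+) (d.2 == j)))
      (site_pauli R (site j) q) (\prod_(d <- E) stab d) by rewrite sum_dimer_ends.
  apply: sign_commute_prod => d dE.
  rewrite -fj -!fE ?P1 ?P2 //.
  by apply: stab_sign_commute; apply: site_pauli_majorana.
move: j0A; rewrite inE negb_and -ltnNge -leqNgt => /orP[j0a|j0b].
  case: (@arg_minnP _ j0 P (fun j => j : nat)) => // j Pj jmin.
  apply: (key j (true, odd j) (fun j' => j' != j)) => //.
  - by rewrite inE; have := half_leq (jmin _ Pj0); move: j0a => /=; lia.
  - by move=> j' Pj'; apply/form_below/jmin.
  - by move=> d; rewrite addNb addbN negbK.
case: (@arg_maxnP _ j0 P (fun j => j : nat)) => // j Pj jmax.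
apply: (key j (true, ~~ odd j) (fun j' => j' == j)) => //.
- by rewrite inE; have := half_leq (jmax _ Pj0); move: j0b => /=; lia.
- by move=> j' Pj'; apply/form_above/jmax.
Qed.

(** The projections are expanded one at a time, [E] collecting the stabilizers already chosen. Only
    the choice of the identity in every factor survives the partial trace. *)
Lemma ptrace_half_stab_prod a b (r E : seq dimer) :
  uniq (E ++ r) -> {subset E ++ r <= outer_dimers Omega (site_interval a b)} ->
  ptrace (site_interval a b) (\prod_(d <- E) stab d *m \prod_(d <- r) half_stab d)
    = if E is [::] then 2^-1 ^+ size r *: ptrace (site_interval a b) 1%:M else 0.
Proof.
elim: r E => [|d r IH] E uE EA.
  rewrite big_nil mulmx1; case: E uE EA => [|e E] uE EA.
    by rewrite big_nil expr0 scale1r.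
  by apply: ptrace_stab_prod_eq0; rewrite // -(cats0 (e :: E)).
have uE' : uniq (rcons E d ++ r) by rewrite cat_rcons.
have EA' : {subset rcons E d ++ r <= outer_dimers Omega (site_interval a b)}.
  by rewrite cat_rcons.
have sub : subseq (E ++ r) (E ++ d :: r) by rewrite cat_subseq // subseq_cons.
have -> : \prod_(e <- E) stab e *m \prod_(e <- d :: r) half_stab e
    = 2^-1 *: (\prod_(e <- E) stab e *m \prod_(e <- r) half_stab e
       + \prod_(e <- rcons E d) stab e *m \prod_(e <- r) half_stab e).
  have -> : \prod_(e <- d :: r) half_stab e = half_stab d *m \prod_(e <- r) half_stab e.
    by rewrite big_cons.
  have -> : \prod_(e <- rcons E d) stab e = \prod_(e <- E) stab e *m stab d.
    by rewrite -cats1 big_cat big_seq1.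
  by rewrite -scalemxAl -scalemxAr mulmxDl mul1mx mulmxDr mulmxA.
rewrite ptraceZ ptraceD IH ?(subseq_uniq sub) // => [|e /(mem_subseq sub) /EA //].
rewrite IH //; case: E {uE EA uE' EA' sub IH} => [|e E] /=.
  by rewrite addr0 scalerA exprS.
by rewrite addr0 scaler0.
Qed.

(** The property of an operator [v] tensored with the identity that the argument uses; in this form
    it passes to products at once. *)
Definition acts_inside A (V : op) :=
  exists v : 'M[C]_#|config A|, forall M, ptrace A (V *m M) = v *m ptrace A M.

Lemma acts_insideM A U V : acts_inside A U -> acts_inside A V -> acts_inside A (U *m V).
Proof.
by move=> [u hu] [v hv]; exists (u *m v) => M; rewrite -mulmxA hu hv mulmxA.
Qed.

Lemma acts_inside1 A : acts_inside A 1%:M.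
Proof. by exists 1%:M => M; rewrite !mul1mx. Qed.

(** Outside the interval the two Jordan-Wigner strings agree, both Z on the left and both trivial on
    the right, so they cancel. *)
Lemma half_stab_inside a b d :
  site d.1 \in site_interval a b -> site d.2 \in site_interval a b ->
  acts_inside (site_interval a b) (half_stab d).
Proof.
set A := site_interval a b => d1 d2.
pose f i := pauli R (mode_pauli d.1 i) *m pauli R (mode_pauli d.2 i).
have f1 i : i \notin A -> f i = 1%:M.
  move: d1 d2; rewrite !inE => /andP[a1 b1] /andP[a2 b2].
  rewrite negb_and -ltnNge -leqNgt => iA; rewrite /f.
  have -> : mode_pauli d.2 i = mode_pauli d.1 i; last exact: pauli_sqr.
  rewrite /mode_pauli -!val_eqE; case/orP: iA => ia.
    by rewrite (leq_trans ia a1) (leq_trans ia a2).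
  by rewrite !ltnNge !(ltnW (leq_trans _ ia)) //= !gtn_eqF // (leq_trans _ ia).
exists (2^-1 *: (1%:M - dimer_phase d *: tensor (fun u : {i | i \in A} => f (val u)))) => M.
rewrite /half_stab /stab !majoranaE tensor_mul -!scalemxAl ptraceZ; congr (_ *: _).
rewrite !mulmxDl !mul1mx -!scalemxAl ptraceD ptraceZ (ptrace_tensorM_in _ f1).
by rewrite scaleNr mulNmx scalemxAl.
Qed.

Lemma half_stab_prod_inside a b (r : seq dimer) :
  {in r, forall d, (site d.1 \in site_interval a b) && (site d.2 \in site_interval a b)} ->
  acts_inside (site_interval a b) (\prod_(d <- r) half_stab d).
Proof.
elim: r => [|d r IH] rA; first by rewrite big_nil; apply: acts_inside1.
rewrite big_cons; apply: acts_insideM; last first.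
  by apply: IH => e er; apply: rA; rewrite inE er orbT.
by have /andP[d1 d2] := rA d (mem_head d r); apply: half_stab_inside.
Qed.

End Stabilizers.

(** * Reduced states of a normalized dimer state *)

Section DimerState.
Variables (R : realType) (L : nat) (Omega : {set 'I_(2 * L) * 'I_(2 * L)}).
Variable p : 'I_(2 * L) * 'I_(2 * L) -> bool.
Variable psi : 'cV[R[i]]_#|spins L|.
Local Notation C := R[i].
Hypothesis psi_dimer : majorana_dimer_state Omega p psi.
Hypothesis psi_normal : \sum_x `|psi x 0| ^+ 2 = 1.

Let Omega_dimer : dimer_partition Omega. Proof. by case: psi_dimer. Qed.

Lemma stab_psi d : d \in Omega -> stab R p d *m psi = psi.
Proof.
case: psi_dimer => _ _ ann dO; have /(congr1 (mulmx (majorana R d.1))) := ann d dO.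
rewrite mulmx0 mulmxDl mulmxDr !(mulmxA _ _ psi) majorana_sqr mul1mx -scalemxAr => /eqP.
by rewrite addr_eq0 => /eqP psiE; rewrite /stab scaleNr mulNmx.
Qed.

Lemma half_stab_prod_psi (r : seq ('I_(2 * L) * 'I_(2 * L))) :
  {subset r <= Omega} -> (\prod_(d <- r) half_stab R p d) *m psi = psi.
Proof.
elim: r => [|d r IH] rO; first by rewrite big_nil mul1mx.
have -> : \prod_(e <- d :: r) half_stab R p e
    = half_stab R p d *m \prod_(e <- r) half_stab R p e by rewrite big_cons.
rewrite -mulmxA IH => [|e er]; last by apply: rO; rewrite inE er orbT.
rewrite /half_stab -scalemxAl mulmxDl mul1mx stab_psi ?rO ?mem_head //.
by rewrite -mulr2n -[X in _ *: X = _]scaler_nat scalerA mulVf ?pnatr_eq0 // scale1r.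
Qed.

(** The enumeration [r] is left free so that the dimers inside a subsystem can later be listed
    first. *)
Lemma ketbra_half_stab_prod (r : seq ('I_(2 * L) * 'I_(2 * L))) :
  perm_eq r (enum Omega) -> psi *m psi ^t* = \prod_(d <- r) half_stab R p d.
Proof.
move=> rE; have rO d : (d \in r) = (d \in Omega) by rewrite (perm_mem rE) mem_enum.
have ur : uniq r by rewrite (perm_uniq rE) enum_uniq.
apply: projmx_rank1 => //.
- apply: projmx_prod => [d|d e]; rewrite !rO; first exact: half_stab_proj.
  exact: half_stab_commute.
- by apply: half_stab_prod_psi => d; rewrite rO.
(* For the empty interval all dimers are outer, so the expansion computes the full trace: [2^-L]
   times the dimension [2^L]. *)
have Out : {subset [::] ++ r <= outer_dimers Omega (site_interval L 0 0)}.
  by move=> d; rewrite !inE rO => ->; rewrite ltn0 andbF.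
have := ptrace_half_stab_prod R p Omega_dimer (E := [::]) (r := r) ur Out.
rewrite big_nil mul1mx => /(congr1 (@mxtrace _ _)).
rewrite linearZ /= !mxtrace_ptrace mxtrace1 => ->.
rewrite (perm_size rE) -cardE (card_dimers Omega_dimer) card_ffun !card_ord.
by rewrite natrX exprVn mulVf // expf_neq0 // pnatr_eq0.
Qed.

(** The scalar kappa: one factor 1/2 for each outer projection, times the trace of the identity on
    the environment. *)
Definition flatness (a b : nat) : R :=
  2^-1 ^+ #|outer_dimers Omega (site_interval L a b)| * 2 ^+ #|~: site_interval L a b|.

Local Notation rho A := (ptrace A (psi *m psi ^t*)).

Lemma rho_flat a b :
  rho (site_interval L a b) *m rho (site_interval L a b)
    = (flatness a b)%:C *: rho (site_interval L a b).
Proof.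
set A := site_interval L a b.
pose inner := [set d in Omega | (site d.1 \in A) && (site d.2 \in A)].
have perm : perm_eq (enum inner ++ enum (outer_dimers Omega A)) (enum Omega).
  apply: uniq_perm; rewrite ?enum_uniq // ?cat_uniq ?enum_uniq ?andbT //=.
    by apply/hasPn => d; rewrite !mem_enum !inE => /andP[-> /negPf ->].
  by move=> d; rewrite mem_cat !mem_enum !inE -andb_orr orbN andbT.
have [|v vE] := half_stab_prod_inside R p (a := a) (b := b) (r := enum inner).
  by move=> d; rewrite mem_enum inE => /andP[].
(* The product of the inner projections fixes [psi], so the operator [v] it induces on [A] fixes the
   reduced state. *)
have vrho : v *m rho A = rho A.
  rewrite -vE mulmxA half_stab_prod_psi // => d.
  by rewrite mem_enum inE => /andP[].
(* With the inner projections listed first, [v] leaves the partial trace and the outer projections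
   contribute a scalar. *)
have rhoE : rho A = (flatness a b)%:C *: v.
  rewrite (ketbra_half_stab_prod perm) big_cat /= -mulmxE vE.
  have := ptrace_half_stab_prod R p Omega_dimer (a := a) (b := b) (E := [::])
    (r := enum (outer_dimers Omega A)).
  rewrite big_nil mul1mx => ->; rewrite /= ?enum_uniq //; last first.
    by move=> d; rewrite mem_enum.
  rewrite ptrace1 -cardE -scalemxAr mul_mx_scalar scalerA; congr (_ *: _).
  by rewrite natrX /flatness rmorphM !rmorphXn fmorphV !rmorph_nat.
by rewrite {1}rhoE -scalemxAl vrho.
Qed.

(** For the Schmidt matrix [S], flatness on the interval gives [S S^* S = k S]; multiplying by [S^*]
    on the left gives flatness of [S^* S], and the transpose respects squares. *)
Lemma rhoC_flat a b :
  rho (~: site_interval L a b) *m rho (~: site_interval L a b)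
    = (flatness a b)%:C *: rho (~: site_interval L a b).
Proof.
have := rho_flat a b; rewrite ptraceC_ketbra ptrace_ketbra.
move: (schmidt_mx _ _) (flatness a b) => S k SS.
have kR : k%:C \is Num.real by apply/complex_realP; exists k.
have SSS := mul_adj_eq_scale kR SS.
have KK : (S ^t* *m S) *m (S ^t* *m S) = k%:C *: (S ^t* *m S).
  by rewrite -(mulmxA (S ^t*) S) (mulmxA S (S ^t*) S) SSS -scalemxAr.
by rewrite -trmx_mul KK linearZ.
Qed.

Lemma entropy_of_flat A (k : R) :
  rho A *m rho A = k%:C *: rho A -> entanglement_entropy psi A = (- ln k)%:C.
Proof.
move=> flat; apply: entropy_flat => //.
  by rewrite ptrace_adj adjmxM trmxCK.
rewrite mxtrace_ptrace mxtrace_mulC /mxtrace big_ord1 mxE -[RHS]psi_normal.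
by apply: eq_bigr => x _; rewrite adjmxE normCKC.
Qed.

(** With [m] outer dimers and [n] environment sites the left side is [(m - n) ln 2], and the mode
    count says that [2 (m - n)] dimers cross. *)
Lemma ln_flatness a b :
  - ln (flatness a b) = ln 2 / 2 * #|crossing_dimers Omega (site_interval L a b)|%:R.
Proof.
have := card_outer_dimers Omega_dimer (site_interval L a b).
rewrite /flatness lnM ?posrE ?exprn_gt0 ?invr_gt0 // !lnXn ?invr_gt0 //.
set m := #|outer_dimers _ _|; set n := #|~: _|; set c := #|crossing_dimers _ _|.
move=> /(congr1 (fun k : nat => k%:R : R)); rewrite natrD !natrM lnV ?posrE // => mnc.
rewrite -[_ *+ m]mulr_natr -[_ *+ n]mulr_natr.
have -> : (c%:R : R) = 2 * (m%:R - n%:R) by rewrite mulrBr mnc addrAC subrr add0r.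
by rewrite mulrA divfK ?pnatr_eq0 // mulrBr mulNr opprD opprK.
Qed.

End DimerState.

(** * Cyclic intervals and the entropy formula *)

Lemma crossing_dimersC L (Omega : {set 'I_(2 * L) * 'I_(2 * L)}) (A : {set 'I_L}) :
  crossing_dimers Omega (~: A) = crossing_dimers Omega A.
Proof.
apply/setP => d; rewrite !inE !negbK; congr (_ && _).
by rewrite orbC andbC [X in _ || X]andbC.
Qed.

Lemma connected_interval L (A : {set 'I_L}) : connected_subsystem A ->
  exists a b, A = site_interval L a b \/ A = ~: site_interval L a b.
Proof.
move=> [a [l [lL AE]]].
(* Without sites all subsystems coincide; otherwise the starting site can be reduced modulo [L]. *)
have [L0|Lpos] := posnP L.
  by exists 0, 0; left; apply/setP => i; exfalso; have := ltn_ord i; lia.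
have mE i : (i \in A) = [exists m : 'I_l, val i == ((a %% L + m) %% L)%N].
  by rewrite AE inE; apply: eq_existsb => m; rewrite modnDml.
move: (a %% L)%N (ltn_pmod a Lpos) mE => c cL {}mE {a AE}.
have [cl|cl] := leqP (c + l) L.
  exists c, (c + l)%N; left; apply/setP => i; rewrite mE inE.
  apply/existsP/idP => [[m /eqP/= iE]|/andP[ci il]].
    by have ml := ltn_ord m; move: iE; rewrite modn_small; lia.
  have im : (i - c < l)%N by lia.
  by exists (Ordinal im); have iL := ltn_ord i; rewrite /= modn_small; lia.
(* The arc wraps around once, and the sites it misses run from its end [c + l - L] up to its start
   [c]. *)
exists (c + l - L)%N, c; right; apply/setP => i; rewrite mE !inE.
apply/existsP/idP => [[m /eqP/= iE]|iN].
  have ml := ltn_ord m; move: iE; have [?|?] := ltnP (c + m) L.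
    by rewrite modn_small; lia.
  by rewrite -{1}(@subnK L (c + m)) // modnDr modn_small; lia.
have iL := ltn_ord i.
(* A site from [c] on is reached before wrapping, with offset [i - c]; the others afterwards, with
   offset [i + L - c]. *)
have [ci|ic] := leqP c i.
  have im : (i - c < l)%N by lia.
  by exists (Ordinal im); rewrite /= modn_small; lia.
have im : (i + L - c < l)%N by lia.
exists (Ordinal im); rewrite /= addnC subnK; last by lia.
by rewrite modnDr modn_small.
Qed.

Theorem mainTheorem6 (R : realType) (L : nat)
    (Omega : {set 'I_(2 * L) * 'I_(2 * L)})
    (p : 'I_(2 * L) * 'I_(2 * L) -> bool)
    (psi : 'cV[R[i]]_#|spins L|) (A : {set 'I_L}) :
  majorana_dimer_state Omega p psi ->
  \sum_x `|psi x 0| ^+ 2 = 1 ->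
  connected_subsystem A ->
  entanglement_entropy psi A
    = (ln 2 / 2 * #|crossing_dimers Omega A|%:R)%:C.
Proof.
move=> psi_dimer psi_normal /connected_interval[a [b [->|->]]].
  by rewrite (entropy_of_flat psi_normal (rho_flat psi_dimer psi_normal a b))
             (ln_flatness psi_dimer).
by rewrite (entropy_of_flat psi_normal (rhoC_flat psi_dimer psi_normal a b))
           (ln_flatness psi_dimer) crossing_dimersC.
Qed.
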